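(* For every choice of parameters of the Diamond ensemble and every $M$, the collection of regions $R_N$, $R_S$, $R_j^i$ ($1\le j\le 2M-1$, $1\le i\le r_j$) defined in the context is an area regular partition of $\mathbb{S}^2$: the regions cover $\mathbb{S}^2$, they have pairwise disjoint interiors, and each of the $N$ regions has area $\frac{4\pi}{N}$.
   Context: Parameters. Let $M,n$ be positive integers, $A\ge2$, $c>0$, and let $0=t_0<t_1<\dots<t_n=M$ and $\alpha_1,\dots,\alpha_n,\beta_1,\dots,\beta_n$ be integers such that: $\alpha_1=0$; $\alpha_\ell,\beta_\ell\ge 0$; $\beta_1>0$; $\alpha_\ell\le AM$ and $\beta_\ell\le A$ for all $\ell$; $t_1\ge cM$; and the function $r:[0,2M]\to\mathbb{R}$ defined by $r(x)=\alpha_\ell+\beta_\ell x$ for $t_{\ell-1}\le x\le t_\ell$ and $r(x)=r(2M-x)$ is well defined and continuous. Put $r_j=r(j)$ for $1\le j\le 2M-1$, $N=2+\sum_{j=1}^{2M-1}r_j$, and $N_j=1+\sum_{k=1}^{j-1}r_k$. Let $\theta_j\in[0,2\pi]$ be arbitrary phases. Regions. For $1\le j\le M$ let $h_j=1-\frac{2N_j}{N}$ (equivalently $h_1=1-\frac2N$ and $h_{j+1}=h_j-\frac{2r_j}{N}$). Points of the unit sphere $\mathbb{S}^2$ are described by (azimuth mod $2\pi$, polar angle in $[0,\pi]$ measured from the North pole). The regions are: - $R_N$, the spherical cap centered at the North pole with height $1-h_1$, i.e. $\{(x,y,z)\in\mathbb{S}^2: z\ge h_1\}$; - for $1\le j\le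 M-1$, $1\le i\le r_j$: $R_j^i=\left[\frac{2\pi i}{r_j}+\frac{\pi}{r_j}+\theta_j,\ \frac{2\pi(i+1)}{r_j}+\frac{\pi}{r_j}+\theta_j\right]\times[\arccos h_j,\arccos h_{j+1}]$; - for $1\le i\le r_M$: $R_M^i=\left[\frac{2\pi i}{r_M}+\frac{\pi}{r_M}+\theta_M,\ \frac{2\pi(i+1)}{r_M}+\frac{\pi}{r_M}+\theta_M\right]\times[\arccos h_M,\pi-\arccos h_M]$; - the symmetric regions in the South hemisphere: $R_S=\{z\le -h_1\}$ and, for $1\le j\le M-1$, $1\le i\le r_j$, $R_{2M-j}^i=\left[\frac{2\pi i}{r_j}+\frac{\pi}{r_j}+\theta_{2M-j},\ \frac{2\pi(i+1)}{r_j}+\frac{\pi}{r_j}+\theta_{2M-j}\right]\times[\pi-\arccos h_{j+1},\pi-\arccos h_j]$. *)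

(* Defs.v *)
From HB Require Import structures.
From mathcomp Require Import all_boot all_order all_algebra.
From mathcomp Require Import all_classical all_reals all_analysis.

Set Implicit Arguments.
Unset Strict Implicit.
Unset Printing Implicit Defensive.

Import Order.TTheory GRing.Theory Num.Theory.
Import numFieldNormedType.Exports.

Local Open Scope classical_set_scope.
Local Open Scope ring_scope.

Section Sphere.
Context {R : realType}.

(* Euclidean, unlike the library norm on 'rV, which is the sup norm. *)
Definition dot (u v : 'rV[R]_3) : R := \sum_(k < 3) u 0 k * v 0 k.

Definition S2 : set 'rV[R]_3 := [set x | dot x x = 1].

(* a = azimuth, p = polar angle measured from the North pole *)
Definition sph (a p : R) : 'rV[R]_3 :=
  \row_(k < 3) [:: sin p * cos a; sin p * sin a; cos p]`_k.

Definition sph_da (a p : R) : 'rV[R]_3 :=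
  \row_(k < 3) derive1 (fun u => sph u p 0 k) a.
Definition sph_dp (a p : R) : 'rV[R]_3 :=
  \row_(k < 3) derive1 (fun u => sph a u 0 k) p.

(* Square root of the Gram determinant (first fundamental form) of sph. *)
Definition area_element (a p : R) : R :=
  Num.sqrt (dot (sph_da a p) (sph_da a p) * dot (sph_dp a p) (sph_dp a p)
            - dot (sph_da a p) (sph_dp a p) ^+ 2).

(* sph maps this box onto S2, injectively away from the two poles. *)
Definition sph_domain : set (R * R) := `[0, 2 * pi[ `*` `[0, pi].

Definition area (E : set 'rV[R]_3) : \bar R :=
  (\int[(@lebesgue_measure R \x @lebesgue_measure R)]_(x in
      sph_domain `&` [set x | E (sph x.1 x.2)]) (area_element x.1 x.2)%:E)%E.

(* Regions are only required to have disjoint interiors, and these are taken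
   in S2 (in R^3 every subset of S2 has empty interior). *)
Definition area_regular_partition (I : Type) (D : set I)
    (F : I -> set 'rV[R]_3) (N : R) : Prop :=
  [/\ exists2 m : nat, (D #= `I_m)%card & N = m%:R,
      \bigcup_(k in D) F k = S2,
      trivIset D (fun k => interior (F k : set (subspace S2))) &
      forall k, D k -> area (F k) = (4 * pi / N)%:E].

End Sphere.

Inductive region_index : Type := North | South | Belt of nat & nat.

Section Diamond.
Context {R : realType}.
Variables (M : nat) (r : R -> R) (theta : nat -> R).

Definition rj (j : nat) : R := r j%:R.

Definition Ntot : R := 2 + \sum_(1 <= j < 2 * M) rj j.

Definition Nj (j : nat) : R := 1 + \sum_(1 <= k < j) rj k.

Definition hj (j : nat) : R := 1 - 2 * Nj j / Ntot.

(* The azimuth is taken modulo 2 pi by the periodicity of sph. *)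
Definition spherical_box (A P : set R) : set 'rV[R]_3 :=
  [set sph x.1 x.2 | x in A `*` P].

(* s is the number of boxes in the belt, th its phase *)
Definition azimuths (s th : R) (i : nat) : set R :=
  `[2 * pi * i%:R / s + pi / s + th, 2 * pi * i.+1%:R / s + pi / s + th].

Definition belt_region (j i : nat) : set 'rV[R]_3 :=
  if (j < M)%N then
    spherical_box (azimuths (rj j) (theta j) i)
      `[acos (hj j), acos (hj j.+1)]
  else if j == M then
    spherical_box (azimuths (rj M) (theta M) i)
      `[acos (hj M), pi - acos (hj M)]
  else
    let j' := (2 * M - j)%N in
    spherical_box (azimuths (rj j') (theta j) i)
      `[pi - acos (hj j'.+1), pi - acos (hj j')].

Definition region (k : region_index) : set 'rV[R]_3 :=
  match k with
  | North => [set x | S2 x /\ hj 1 <= x 0 ord_max]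
  | South => [set x | S2 x /\ x 0 ord_max <= - hj 1]
  | Belt j i => belt_region j i
  end.

Definition region_indices : set region_index :=
  [set k | match k with
           | North | South => True
           | Belt j i => (1 <= j <= 2 * M - 1)%N /\ (1 <= i)%N /\ i%:R <= rj j
           end].

End Diamond.

(* Main.v *)
Require Import Defs.
From HB Require Import structures.
From mathcomp Require Import all_boot all_order all_algebra.
From mathcomp Require Import all_classical all_reals all_analysis.
From mathcomp Require Import measurable_realfun ring lra zify.

Import Order.TTheory GRing.Theory Num.Theory.
Import numFieldNormedType.Exports.

Local Open Scope classical_set_scope.
Local Open Scope ring_scope.

(* The two caps are belts with a single box: with r_0 = r_(2M) = 1 every region
   is the image of a box of longitudes and latitudes, and the j-th belt
   (0 <= j <= 2M) lies between the heights 1 - 2 (r_0 + ... + r_(j-1)) / N and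
   1 - 2 (r_0 + ... + r_j) / N. By Archimedes' theorem a box of angular width d
   between heights z and z' has area d (z - z'), here (2 pi / r_j) (2 r_j / N).
   Boxes of the family do not meet the open boxes of the others, and every box
   lies in the closure of its open box, so the interiors are disjoint.
   The numbers r_j are positive integers because by continuity the affine pieces
   agree at the t_l, and r increases on [0, M] from r(0) = 0 with slope
   beta_1 > 0 at first. *)

(** * Spherical coordinates: periodicity, surjectivity, injectivity, continuity *)

Section SphericalCoordinates.
Set Implicit Arguments.
Unset Strict Implicit.
Unset Printing Implicit Defensive.
Context {R : realType}.
Implicit Types (a b p u v : R) (x : 'rV[R]_3).
Local Notation mu := (@lebesgue_measure R).

Lemma cosDz2pi a (k : int) : cos (a + 2 * pi * k%:~R) = cos a.
Proof.
have H (n : nat) b : cos (b + 2 * pi * n%:R) = cos b.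
  by rewrite mulr_natr -(periodicn (@cosD2pi R) n b) mulr_natl.
case: k => n; first exact: H.
rewrite NegzE mulrNz -(H n.+1 (a + _)); congr cos.
by rewrite pmulrn; ring.
Qed.

Lemma sinDz2pi a (k : int) : sin (a + 2 * pi * k%:~R) = sin a.
Proof. by rewrite -!cosBpihalf addrAC cosDz2pi. Qed.

Lemma sphDz2pi a p (k : int) : sph (a + 2 * pi * k%:~R) p = sph a p.
Proof. by apply/rowP => i; rewrite !mxE cosDz2pi sinDz2pi. Qed.

Lemma sph0E a p : sph a p 0 (inord 0) = sin p * cos a.
Proof. by rewrite mxE inordK. Qed.

Lemma sph1E a p : sph a p 0 (inord 1) = sin p * sin a.
Proof. by rewrite mxE inordK. Qed.

Lemma sph2E a p : sph a p 0 ord_max = cos p.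
Proof. by rewrite mxE. Qed.

Lemma rV3P (x y : 'rV[R]_3) : x 0 (inord 0) = y 0 (inord 0) ->
  x 0 (inord 1) = y 0 (inord 1) -> x 0 ord_max = y 0 ord_max -> x = y.
Proof.
move=> e0 e1 e2; apply/rowP => -[[|[|[|//]]] i3].
- by move: e0; congr (_ = _); congr (_ 0 _); apply/val_inj; rewrite /= inordK.
- by move: e1; congr (_ = _); congr (_ 0 _); apply/val_inj; rewrite /= inordK.
- by move: e2; congr (_ = _); congr (_ 0 _); apply/val_inj.
Qed.

Lemma dot3E (x y : 'rV[R]_3) : dot x y =
  x 0 (inord 0) * y 0 (inord 0) + x 0 (inord 1) * y 0 (inord 1) +
  x 0 ord_max * y 0 ord_max.
Proof.
rewrite /dot !big_ord_recr big_ord0 /= add0r.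
by congr (_ + _ + _); congr (_ * _); congr (_ 0 _); apply/val_inj;
  rewrite /= ?inordK.
Qed.

Lemma sph_in_S2 a p : S2 (sph a p).
Proof.
rewrite /S2 /= dot3E sph0E sph1E sph2E.
have := cos2Dsin2 a; have := cos2Dsin2 p => Hp Ha.
have -> : sin p * cos a * (sin p * cos a) + sin p * sin a * (sin p * sin a) +
  cos p * cos p = sin p ^+ 2 * (cos a ^+ 2 + sin a ^+ 2) + cos p ^+ 2 by ring.
by rewrite Ha mulr1 addrC.
Qed.

(** The angle is [acos u] up to sign, and the sign of [v] decides which. *)
Lemma circle_angle u v : u ^+ 2 + v ^+ 2 = 1 -> exists a, u = cos a /\ v = sin a.
Proof.
move=> uv; have u1 : -1 <= u <= 1.
  by apply/andP; split; nra.
have sE : sin (acos u) = `|v|.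
  by rewrite sin_acos// -sqrtr_sqr; congr Num.sqrt; lra.
have [v0|v0] := leP 0 v.
- by exists (acos u); rewrite acosK// sE ger0_norm.
- by exists (- acos u); rewrite cosN sinN acosK// sE ltr0_norm// opprK.
Qed.

Lemma sph_surj x : S2 x -> exists a, x = sph a (acos (x 0 ord_max)).
Proof.
rewrite /S2 /= dot3E => x1.
set z := x 0 ord_max in x1 *; set u := x 0 (inord 0) in x1 *.
set v := x 0 (inord 1) in x1 *.
have z1 : -1 <= z <= 1 by apply/andP; split; nra.
have cz : cos (acos z) = z by rewrite acosK.
have sz := cos2Dsin2 (acos z); rewrite cz in sz.
(* At a pole the first two coordinates vanish and any azimuth works; 0 is chosen. *)
have [s0|s0] := eqVneq (sin (acos z)) 0.
  rewrite s0 in sz; exists 0; apply: rV3P; rewrite ?sph0E ?sph1E ?sph2E ?cz//;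
  rewrite s0 mul0r -/u -/v; nra.
have [|a [ua va]] := @circle_angle (u / sin (acos z)) (v / sin (acos z)).
  rewrite !exprMn -mulrDl exprVn.
  have -> : u ^+ 2 + v ^+ 2 = sin (acos z) ^+ 2 by lra.
  by rewrite divff ?expf_neq0.
exists a; apply: rV3P; rewrite ?sph0E ?sph1E ?sph2E ?cz// -?ua -?va -/u -/v mulrC
  divfK//.
Qed.

(** Injectivity of [cos] on $[0,\pi]$ applies to $|a|$, or else to $2\pi-|a|$, which would then
    vanish against the strict bound. *)
Lemma cos_eq1_small a : cos a = 1 -> `|a| < 2 * pi -> a = 0.
Proof.
move=> ca aB; have [ap|pa] := leP `|a| pi.
  have /cos_inj : cos `|a| = cos 0 by rewrite cos_norm cos0.
  rewrite !in_itv/= ap normr_ge0 pi_ge0 lexx => /(_ isT isT) /eqP.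
  by rewrite normr_eq0 => /eqP.
have /cos_inj : cos (2 * pi - `|a|) = cos 0.
  by rewrite -cosN opprB -(cosDz2pi _ 1) mulr1 subrK cos_norm cos0.
rewrite !in_itv/= pi_ge0 lexx /=; move=> H; suff : 2 * pi - `|a| = 0 by lra.
by apply: H => //; apply/andP; split; lra.
Qed.

(** Chooses the representative of an azimuth in a prescribed turn starting at [b]. *)
Lemma azimuth_shift a b : exists k : int, b <= a + 2 * pi * k%:~R < b + 2 * pi.
Proof.
have pi0 := pi_gt0 R.
exists (- Num.floor ((a - b) / (2 * pi))); rewrite mulrNz.
have := floor_itv ((a - b) / (2 * pi)); rewrite ler_pdivlMr ?ltr_pdivrMr; lra.
Qed.

Lemma sph_inj a a' p p' : 0 <= p <= pi -> 0 <= p' <= pi ->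
  sph a p = sph a' p' -> p = p'.
Proof.
by move=> pP pP' /rowP/(_ ord_max); rewrite !sph2E => /cos_inj ->.
Qed.

(** Off the poles $\sin p$ cancels, so both azimuths give the same point of the circle;
    $\cos(a-a')=1$ records this congruence modulo $2\pi$. *)
Lemma sph_azimuth a a' p : 0 < p < pi -> sph a p = sph a' p ->
  cos (a - a') = 1.
Proof.
move=> /sin_gt0_pi s0 e.
have := congr1 (fun x : 'rV[R]_3 => x 0 (inord 0)) e.
have := congr1 (fun x : 'rV[R]_3 => x 0 (inord 1)) e.
rewrite !sph0E !sph1E => /(mulfI (lt0r_neq0 s0)) e1 /(mulfI (lt0r_neq0 s0)) e0.
by rewrite cosB e0 e1 -!expr2 cos2Dsin2.
Qed.

Lemma sph_continuous : continuous (fun y : R * R => sph y.1 y.2).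
Proof.
move=> -[a p] /= U.
move=> /nbhs_ballP[e /= e0 eU]; rewrite /nbhs /=.
have H (k : 'I_3) : {for (a, p), continuous (fun y : R * R => sph y.1 y.2 0 k)}.
  have c1 : (y.1 @[y --> (a, p)] --> a)%classic by exact: cvg_fst.
  have c2 : (y.2 @[y --> (a, p)] --> p)%classic by exact: cvg_snd.
  have cs1 := cvg_comp _ _ c1 (@continuous_sin R a).
  have cc1 := cvg_comp _ _ c1 (@continuous_cos R a).
  have cs2 := cvg_comp _ _ c2 (@continuous_sin R p).
  have cc2 := cvg_comp _ _ c2 (@continuous_cos R p).
  case: k => -[|[|[|//]]] i3; rewrite /prop_for /continuous_at;
    under eq_fun do rewrite mxE;
    rewrite mxE /=.
  - exact: cvgM cs2 cc1.
  - exact: cvgM cs2 cs1.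
  - exact: cc2.
(* Balls of ['rV] are defined coordinatewise, so three neighbourhoods, one per coordinate, are
   intersected. *)
have : \forall y \near (a, p), forall k : 'I_3, ball (sph a p 0 k) e (sph y.1 y.2 0 k).
  apply: (@filter_forall _ _ (fun k y => ball (sph a p 0 k) e (sph y.1 y.2 0 k)) _
    (nbhs_filter (a, p))) => k.
  exact: (H k _ (nbhsx_ballx (sph a p 0 k) e e0)).
apply: filterS => y yP; apply: eU; split => // i k; rewrite ord1; exact: yP.
Qed.

Lemma itvoo_approx a0 a1 a (e : R) : a0 < a1 -> a0 <= a <= a1 -> 0 < e ->
  exists2 b, a0 < b < a1 & `|a - b| < e.
Proof.
(* The point moves by [d] away from the nearer endpoint: a quarter of the length keeps it inside,
   half of [e] keeps it close. *)
move=> a01 aP e0; pose d := Num.min (e / 2) ((a1 - a0) / 4).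
have d0 : 0 < d by rewrite lt_min; apply/andP; split; lra.
have de : d <= e / 2 by rewrite ge_min lexx.
have da : d <= (a1 - a0) / 4 by rewrite ge_min lexx orbT.
have [am|am] := leP a ((a0 + a1) / 2).
- by exists (a + d); [lra | rewrite opprD addNKr normrN gtr0_norm//; lra].
- by exists (a - d); [lra | rewrite opprB addrC subrK gtr0_norm//; lra].
Qed.

(** The parameters of a boundary point can be pushed slightly into the open rectangle, and [sph] is
    continuous. *)
Lemma spherical_box_interior_dense a0 a1 p0 p1 (U : set 'rV[R]_3) x :
  a0 < a1 -> p0 < p1 -> spherical_box `[a0, a1] `[p0, p1] x ->
  nbhs (x : subspace (@S2 R)) U ->
  exists a p, [/\ a0 < a < a1, p0 < p < p1 & U (sph a p)].
Proof.
move=> a01 p01 [[a p] /= [aP pP] <-].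
move: aP pP; rewrite /= !in_itv /= => aP pP.
(* [V] is a neighbourhood in the ambient space with the same trace on the sphere as [U]. *)
move=> /(nbhs_subspace_ex _ (sph_in_S2 a p))[V + UV].
move=> /(@sph_continuous (a, p)) /nbhs_ballP[e /= e0 eV].
have [a' a'P aa'] := itvoo_approx a01 aP e0.
have [p' p'P pp'] := itvoo_approx p01 pP e0.
exists a', p'; split => //.
suff : (U `&` S2) (sph a' p') by case.
by rewrite UV; split; [exact: (eV (a', p')) | exact: sph_in_S2].
Qed.

(** * The area element and the area of a spherical box *)

Lemma sph_daE a p :
  sph_da a p = \row_(k < 3) [:: - (sin p * sin a); sin p * cos a; 0]`_k.
Proof.
apply/rowP => -[[|[|[|//]]] i3]; rewrite !mxE /= derive1E;
  under [X in derive X]eq_fun do rewrite mxE /=.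
- by rewrite derive_val /GRing.scale /=; ring.
- by rewrite derive_val /GRing.scale /=; ring.
- by rewrite derive_val.
Qed.

Lemma sph_dpE a p :
  sph_dp a p = \row_(k < 3) [:: cos p * cos a; cos p * sin a; - sin p]`_k.
Proof.
apply/rowP => -[[|[|[|//]]] i3]; rewrite !mxE /= derive1E;
  under [X in derive X]eq_fun do rewrite mxE /=.
- by rewrite derive_val /GRing.scale /=; ring.
- by rewrite derive_val /GRing.scale /=; ring.
- by rewrite derive_val.
Qed.

Lemma area_elementE a p : 0 <= p <= pi -> area_element a p = sin p.
Proof.
move=> p0pi; rewrite /area_element sph_daE sph_dpE !dot3E !mxE /= !inordK //=.
have := cos2Dsin2 a; have := cos2Dsin2 p => Hp Ha.
rewrite -[RHS]ger0_norm ?sin_ge0_pi// -sqrtr_sqr; congr Num.sqrt.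
(* The two tangent vectors are orthogonal, so the Gram determinant is the product of their squared
   lengths. *)
transitivity (sin p ^+ 2 * (cos a ^+ 2 + sin a ^+ 2) *
  (cos p ^+ 2 * (cos a ^+ 2 + sin a ^+ 2) + sin p ^+ 2)); first by ring.
by rewrite Ha mulr1 mulr1 Hp mulr1.
Qed.

(** The trace on the fundamental interval of all translates of an arc by multiples of $2\pi$; [area]
    integrates over this interval only. *)
Definition wrapped_arc a0 a1 : set R :=
  `[0, 2 * pi[ `&` [set a | exists k : int, a0 <= a + 2 * pi * k%:~R <= a1].

(** Once its start is shifted into $[0,2\pi)$, an arc of at most one turn ends before $4\pi$, so
    only the arc and its translate by $-2\pi$ can meet the fundamental interval. *)
Lemma wrapped_arc_decomposition a0 a1 : a0 <= a1 <= a0 + 2 * pi ->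
  exists b0 b1, [/\ 0 <= b0 < 2 * pi, b1 - b0 = a1 - a0 &
    wrapped_arc a0 a1 =
      `[0, 2 * pi[ `&` (`[b0, b1] `|` `[b0 - 2 * pi, b1 - 2 * pi])].
Proof.
move=> aP; have pi0 := pi_gt0 R.
have [m mP] := azimuth_shift a0 0; rewrite add0r in mP.
exists (a0 + 2 * pi * m%:~R), (a1 + 2 * pi * m%:~R).
split => //; first by ring.
apply/seteqP; split=> a [/=]; rewrite !in_itv /= => a02 aW; split => //.
  case: aW => k kP.
  have kE : 2 * pi * (m + k)%:~R = 2 * pi * m%:~R + 2 * pi * k%:~R :> R.
    by rewrite intrD mulrDr.
  have mk1 : -1 < m + k.
    rewrite -(ltr_int R) -(ltr_pM2l (_ : 0 < 2 * pi)) ?mulr_gt0//; lra.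
  have mk2 : m + k < 2.
    rewrite -(ltr_int R) -(ltr_pM2l (_ : 0 < 2 * pi)) ?mulr_gt0//; lra.
  have [e|e] : m + k = 0 \/ m + k = 1 by lia.
  - by left; rewrite e in kE; apply/andP; split; lra.
  - by right; rewrite e in kE; apply/andP; split; lra.
case: aW => aW.
- by exists (- m); rewrite mulrNz; apply/andP; split; lra.
- by exists (1 - m); rewrite intrB; apply/andP; split; lra.
Qed.

Lemma measurable_wrapped_arc a0 a1 : a0 <= a1 <= a0 + 2 * pi ->
  measurable (wrapped_arc a0 a1).
Proof.
move=> /wrapped_arc_decomposition[b0 [b1 [_ _ ->]]].
by apply: measurableI => //; exact: measurableU.
Qed.

Lemma measure_wrapped_arc a0 a1 : a0 < a1 <= a0 + 2 * pi ->
  lebesgue_measure (wrapped_arc a0 a1) = (a1 - a0)%:E.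
Proof.
move=> a01; have pi0 := pi_gt0 R.
have [|b0 [b1 [b0P bE ->]]] := @wrapped_arc_decomposition a0 a1; first lra.
(* First case: the arc does not reach $2\pi$ and stays one interval. *)
have [b12|b12] := ltP b1 (2 * pi).
  rewrite (_ : _ `&` _ = `[b0, b1]%classic).
    by rewrite lebesgue_measure_itv /= lte_fin ifT; [rewrite -EFinB bE | lra].
  apply/seteqP; split=> a /=; rewrite !in_itv /=.
    by case=> ? [|]; lra.
  by move=> ?; split; [|left]; lra.
(* Second case: the arc wraps around into two intervals, disjoint because it is shorter than a full
   turn. The second one may be a single point. *)
have [b2|b2] := ltP b1 (b0 + 2 * pi).
  rewrite (_ : _ `&` _ = `[b0, 2 * pi[ `|` `[0, b1 - 2 * pi])%classic.
    set A : set R := [set` `[b0, _[]; set B : set R := [set` `[0, _]].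
    have -> : (lebesgue_measure (A `|` B) =
        lebesgue_measure A + lebesgue_measure B)%E.
      apply: measureU; [exact: measurable_itv | exact: measurable_itv |].
      by apply/seteqP; split=> a //= -[]; rewrite /A /B /= !in_itv/=; lra.
    rewrite !lebesgue_measure_itv /= !lte_fin ifT; last lra.
    case: ifPn => h; rewrite -!EFinB -?EFinD ?adde0; congr EFin; lra.
  apply/seteqP; split=> a /=; rewrite !in_itv /=.
    by case=> ? [|] ?; [left|right]; lra.
  by case=> ?; split; [|left| |right]; lra.
(* Last case: the length is exactly $2\pi$ and the arc covers everything. *)
rewrite (_ : _ `&` _ = `[0, 2 * pi[%classic).
  rewrite lebesgue_measure_itv /= lte_fin ifT; last lra.
  by rewrite -EFinB; congr EFin; lra.
apply/seteqP; split=> a /=; rewrite !in_itv /=; first by case.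
by move=> ?; split => //; have [?|?] := leP b0 a; [left|right]; lra.
Qed.

Lemma integral_sin p0 p1 : p0 < p1 ->
  (\int[mu]_(p in `[p0, p1]) (sin p)%:E = (cos p0 - cos p1)%:E)%E.
Proof.
move=> p01; rewrite (@continuous_FTC2 _ sin (fun p => - cos p))//.
- by rewrite -EFinB opprK addrC.
- by apply: continuous_subspaceT => p; exact: continuous_sin.
- split.
  + by move=> p _; exact: derivableN.
  + by apply: cvgN; apply: cvg_at_right_filter; exact: continuous_cos.
  + by apply: cvgN; apply: cvg_at_left_filter; exact: continuous_cos.
- by move=> p _; rewrite derive1E derive_val opprK.
Qed.

(** Off the poles a point determines its polar angle, and its azimuth modulo $2\pi$, so membership
    can be read on the parameters. *)
Lemma sph_in_box a0 a1 p0 p1 a p : 0 < p < pi -> 0 <= p0 -> p1 <= pi ->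
  spherical_box `[a0, a1] `[p0, p1] (sph a p) <->
  (exists k : int, a0 <= a + 2 * pi * k%:~R <= a1) /\ p0 <= p <= p1.
Proof.
move=> pP p00 p1pi; split=> [[[a' p'] [/= a'P p'P] e]|[[k kP] p01]].
  move: a'P p'P; rewrite !in_itv /= => a'P p'P.
  have pE : p' = p by apply: sph_inj e; lra.
  rewrite {}pE in e p'P; split=> //.
  have [k kP] := azimuth_shift a a'; exists k.
  have e' : sph (a + 2 * pi * k%:~R) p = sph a' p by rewrite sphDz2pi e.
  have := cos_eq1_small (sph_azimuth pP e'); rewrite ger0_norm; last lra.
  by move=> h; have /subr0_eq -> := h ltac:(lra).
exists (a + 2 * pi * k%:~R, p); last exact: sphDz2pi.
by split; rewrite /= in_itv.
Qed.

(** The integrand is the indicator of the wrapped arc times a function of [p] alone; Tonelli's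
    theorem separates the two factors. *)
Lemma area_spherical_box a0 a1 p0 p1 : a0 < a1 <= a0 + 2 * pi ->
  0 <= p0 -> p0 < p1 -> p1 <= pi ->
  area (spherical_box `[a0, a1] `[p0, p1]) =
  ((a1 - a0) * (cos p0 - cos p1))%:E.
Proof.
move=> aP p00 p01 p1pi; rewrite /area integral_mkcond.
pose W := wrapped_arc a0 a1; pose P : set R := `[p0, p1]%classic.
pose f (z : R * R) : \bar R := (\1_W z.1 * (sin z.2 * \1_P z.2))%:E.
have mW : measurable W by apply: measurable_wrapped_arc; lra.
have mP : measurable P by exact: measurable_itv.
have sinP p : 0 <= sin p * \1_P p.
  rewrite indicE; case: (boolP (p \in P)) => [|_]; last by rewrite mulr0.
  by rewrite inE /P /= in_itv /= mulr1 => ?; apply: sin_ge0_pi; lra.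
have mS : measurable_fun setT (fun p => sin p * \1_P p).
  apply: measurable_funM; last exact: measurable_indic.
  by apply: continuous_measurable_fun; exact: continuous_sin.
have mf : measurable_fun [set: R * R] f.
  apply/measurable_EFinP; apply: measurable_funM.
    exact: (measurableT_comp (measurable_indic mW) measurable_fst).
  exact: (measurableT_comp mS measurable_snd).
transitivity (\int[(mu \x mu)%E]_z f z)%E.
  apply: eq_integral => -[a p] _; rewrite patchE /f /=.
  have [pP|pP] := boolP (0 < p < pi).
    have [ain|aout] := boolP (_ \in _).
      move: ain; rewrite inE => -[[/= a02 _] /(sph_in_box _ _ _ pP p00 p1pi)[aW p01']].
      have aW' : a \in W by rewrite inE; split.
      have pP' : p \in P by rewrite inE /P /= in_itv.
      by rewrite !indicE aW' pP' mulr1 mul1r area_elementE//; lra.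
    congr EFin; apply/esym/eqP; rewrite !indicE.
    have [aW|] := boolP (a \in W); last by rewrite mul0r.
    have [p01'|] := boolP (p \in P); last by rewrite !mulr0.
    move: aout aW p01'; rewrite notin_setE !inE /P /= => aout [a02 aW].
    rewrite in_itv /= => p01'; exfalso; apply: aout; split.
      by split => //=; rewrite in_itv /=; lra.
    by apply/(sph_in_box _ _ _ pP p00 p1pi).
  (* At a pole the preimage of the box contains every azimuth, but there the
     area element vanishes. *)
  have [s0|s0] := eqVneq (sin p) 0.
    rewrite s0 mul0r mulr0; case: ifPn => //.
    by rewrite inE => -[[_ /=]]; rewrite in_itv /= => p0pi _; rewrite area_elementE// s0.
  (* What remains is [p] outside $[0,\pi]$, where both integrands vanish. *)
  have pN : ~~ (0 <= p <= pi).
    apply: contra pP => /andP[pge ple]; rewrite !lt_neqAle pge ple !andbT.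
    by apply/andP; split; apply: contra s0 => /eqP pE;
      [rewrite -pE sin0 | rewrite pE sinpi].
  rewrite ifF; last first.
    apply/negbTE; rewrite notin_setE => -[[_ /=]]; rewrite in_itv /= => p0pi _.
    by rewrite p0pi in pN.
  rewrite [\1_P p]indicE; case: (boolP (p \in P)); last by rewrite !mulr0.
  rewrite inE /P /= in_itv /= => p01'; case/negP: pN; lra.
have f0 z : (0 <= f z)%E by rewrite lee_fin mulr_ge0.
transitivity (\int[mu]_a fubini_F mu f a)%E.
  exact: (@fubini_tonelli1 _ _ _ _ R mu mu f mf f0).
pose C : R := cos p0 - cos p1.
transitivity (\int[mu]_a (C%:E * (\1_W a)%:E))%E.
  apply: eq_integral => a _; rewrite /fubini_F /f /=.
  under eq_integral do rewrite EFinM.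
  rewrite ge0_integralZl_EFin//; last 2 first.
  - by move=> p _; rewrite lee_fin sinP.
  - exact: (iffRL (measurable_EFinP _ _) mS).
  rewrite muleC; congr (_ * _)%E.
  rewrite -integral_sin// [RHS]integral_mkcond; apply: eq_integral => p _.
  by rewrite patchE indicE; case: ifPn => _; rewrite ?mulr1 ?mulr0.
rewrite ge0_integralZl_EFin//; last 2 first.
- exact: (iffRL (measurable_EFinP _ _) (measurable_indic mW)).
- by rewrite subr_ge0 leNgt ltr_cos ?in_itv/=; lra.
rewrite integral_indic// setIT mulrC EFinM; congr (_ * _)%E.
exact: measure_wrapped_arc.
Qed.

End SphericalCoordinates.

(** * Monotonicity of the arccosine and location in a subdivision *)

Lemma acos_nincr (R : realType) (u v : R) :
  -1 <= u <= 1 -> -1 <= v <= 1 -> u <= v -> acos v <= acos u.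
Proof.
move=> u1 v1 uv; rewrite leNgt -ltr_cos ?in_itv/= ?acos_ge0 ?acos_lepi//.
by rewrite !acosK ?in_itv//= -leNgt.
Qed.

(** A discrete intermediate value property: either [y] is at most the last but one value, or it lies
    in the last step. *)
Lemma subdivision_cover (R : realType) (f : nat -> R) (m : nat) (y : R) : (0 < m)%N ->
  f 0%N <= y <= f m -> exists2 i, (i < m)%N & f i <= y <= f i.+1.
Proof.
elim: m => // m IH _ /andP[y0 ym]; have [ymm|ymm] := leP y (f m).
  case: m IH ym ymm => [|m] IH ym ymm; first by exists 0%N; rewrite ?y0.
  by have [|i im iP] := IH isT; [rewrite y0|exists i => //; exact: ltnW].
by exists m => //; rewrite ltW.
Qed.

(** * Partitions of the sphere into [K] belts, each cut into equal boxes *)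

Section ZonalPartition.
Set Implicit Arguments.
Unset Strict Implicit.
Unset Printing Implicit Defensive.
Context {R : realType} (K : nat) (s : nat -> nat) (th : nat -> R).
Context (K_gt0 : (0 < K)%N) (s_gt0 : forall [j], (j < K)%N -> (0 < s j)%N).

Definition zone_sum (j : nat) : nat := \sum_(0 <= k < j) s k.

(** The parallel above which the share of the area of the sphere equals the share of boxes in the
    first [j] belts. *)
Definition height (j : nat) : R := 1 - 2 * (zone_sum j)%:R / (zone_sum K)%:R.

Definition polar (j : nat) : R := acos (height j).

Definition arc (j i : nat) : R :=
  2 * pi * i%:R / (s j)%:R + pi / (s j)%:R + th j.

Definition cell (j i : nat) : set 'rV[R]_3 :=
  spherical_box (azimuths (s j)%:R (th j) i) `[polar j, polar j.+1].

Lemma zone_sumS j : zone_sum j.+1 = (zone_sum j + s j)%N.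
Proof. by rewrite /zone_sum big_nat_recr. Qed.

Lemma zone_sum_lt i j : (i < j <= K)%N -> (zone_sum i < zone_sum j)%N.
Proof.
elim: j => // j IH /andP[+ jK]; rewrite ltnS leq_eqVlt zone_sumS.
have := s_gt0 jK; move=> sj /predU1P[->|ij]; first lia.
have := IH _; rewrite ij (ltnW jK) => /(_ isT); lia.
Qed.

Lemma zone_sum_gt0 : 0 < (zone_sum K)%:R :> R.
Proof.
rewrite ltr0n; have := @zone_sum_lt 0 K; rewrite K_gt0 leqnn => /(_ isT).
by case: (zone_sum K).
Qed.

Lemma height_lt i j : (i < j <= K)%N -> height j < height i.
Proof.
move=> /zone_sum_lt; rewrite -(ltr_nat R) => ij.
rewrite ltrD2l ltrN2 ltr_pM2r ?invr_gt0 ?zone_sum_gt0//; lra.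
Qed.

Lemma height0 : height 0 = 1.
Proof. by rewrite /height /zone_sum big_geq// mulr0 mul0r subr0. Qed.

Lemma heightK : height K = -1.
Proof.
by rewrite /height mulfK ?lt0r_neq0 ?zone_sum_gt0//; lra.
Qed.

Lemma height_bound j : (j <= K)%N -> -1 <= height j <= 1.
Proof.
move=> jK; apply/andP; split.
- have [->|ne] := eqVneq j K; first by rewrite heightK.
  by rewrite -heightK ltW// height_lt//; lia.
- have [->|ne] := eqVneq j 0%N; first by rewrite height0.
  by rewrite -height0 ltW// height_lt//; lia.
Qed.

Lemma cos_polar j : (j <= K)%N -> cos (polar j) = height j.
Proof. by move=> /height_bound jB; rewrite /polar acosK. Qed.

Lemma polar_bound j : (j <= K)%N -> 0 <= polar j <= pi.
Proof. by move=> /height_bound jB; rewrite acos_ge0// acos_lepi. Qed.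

Lemma polar_lt i j : (i < j <= K)%N -> polar i < polar j.
Proof.
move=> ij; have iK : (i <= K)%N by lia.
have jK : (j <= K)%N by lia.
by rewrite -ltr_cos ?in_itv/= ?polar_bound// !cos_polar// height_lt.
Qed.

Lemma polar_le i j : (i <= j <= K)%N -> polar i <= polar j.
Proof.
have [->//|ne ij] := eqVneq i j.
by apply/ltW/polar_lt; lia.
Qed.

Lemma polar0 : polar 0 = 0.
Proof. by rewrite /polar height0 acos1. Qed.

Lemma polarK : polar K = pi.
Proof. by rewrite /polar heightK acosN1. Qed.

Lemma arcS j i : arc j i.+1 = arc j i + 2 * pi / (s j)%:R.
Proof. by rewrite /arc -natr1; ring. Qed.

Lemma arc_lt j i i' : (j < K)%N -> (i < i')%N -> arc j i < arc j i'.
Proof.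
move=> /s_gt0 sj ii'; rewrite !ltrD2r ltr_pM2r ?invr_gt0 ?ltr0n//.
by rewrite ltr_pM2l ?ltr_nat// mulr_gt0// pi_gt0.
Qed.

Lemma arc_le j i i' : (j < K)%N -> (i <= i')%N -> arc j i <= arc j i'.
Proof.
by move=> jK; rewrite leq_eqVlt => /predU1P[->//|/(arc_lt jK)/ltW].
Qed.

(** Boxes are numbered from 1, so the belt starts at [arc j 1] and closes up at index [(s j).+1]. *)
Lemma arc_full j : (j < K)%N -> arc j (s j).+1 = arc j 1 + 2 * pi.
Proof.
move=> /s_gt0 sj; rewrite /arc -natr1; field.
by rewrite pnatr_eq0 -lt0n.
Qed.

Lemma cell_sub_S2 j i : cell j i `<=` S2.
Proof. by move=> _ [y _ <-]; exact: sph_in_S2. Qed.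

Lemma S2_height_bound (x : 'rV[R]_3) : S2 x -> -1 <= x 0 ord_max <= 1.
Proof. by rewrite /S2 /= dot3E => ?; apply/andP; split; nra. Qed.

Lemma cell_cover x : S2 x ->
  exists j i, [/\ (j < K)%N, (1 <= i <= s j)%N & cell j i x].
Proof.
move=> xS; have [a xE] := sph_surj xS.
set p := acos _ in xE; have pB : 0 <= p <= pi.
  by rewrite acos_ge0 ?acos_lepi// S2_height_bound.
have [j jK jP] : exists2 j, (j < K)%N & polar j <= p <= polar j.+1.
  by apply: subdivision_cover => //; rewrite polar0 polarK.
(* The azimuth is moved into the turn filled by the boxes of belt [j], then located among its
   dividing meridians. *)
have [k kP] := azimuth_shift a (arc j 1).
have [||i is_ iP] := @subdivision_cover R (fun i => arc j i.+1) (s j)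
    (a + 2 * pi * k%:~R); first exact: s_gt0.
  by rewrite arc_full//; lra.
exists j, i.+1; split => //; exists (a + 2 * pi * k%:~R, p).
  by split; rewrite /azimuths /= in_itv.
by rewrite xE /= sphDz2pi.
Qed.

(** A single box makes a full turn, so only the height is constrained. This identifies the two polar
    caps. *)
Lemma cell_full j : (j < K)%N -> s j = 1%N ->
  cell j 1 = [set x | S2 x /\ height j.+1 <= x 0 ord_max <= height j].
Proof.
move=> jK sj; apply/seteqP; split=> [_ [[a p] [_ /= pP] <-]|x [xS xP]].
  split; first exact: sph_in_S2.
  move: pP; rewrite in_itv /= sph2E => pP.
  have b := polar_bound (ltnW jK); have b' := polar_bound jK.
  by rewrite -(cos_polar jK) -(cos_polar (ltnW jK)) !leNgt !ltr_cos ?in_itv/=;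
    lra.
have [a xE] := sph_surj xS.
have [k kP] := azimuth_shift a (arc j 1).
have arc1 := arc_full jK; rewrite sj in arc1.
exists (a + 2 * pi * k%:~R, acos (x 0 ord_max)); last by rewrite /= sphDz2pi.
have zB := S2_height_bound xS.
have h := height_bound (ltnW jK); have h' := height_bound jK.
split; first by rewrite /azimuths /= in_itv /=; rewrite -!/(arc j _) in arc1 *; lra.
by rewrite /= in_itv /= /polar; apply/andP; split; apply: acos_nincr => //; lra.
Qed.

(** By density, some point of the second box has parameters strictly inside the first; strictness
    then forces equal belts and equal boxes. *)
Lemma cell_interior_disjoint j i j' i' (x : 'rV[R]_3) :
  (j < K)%N -> (1 <= i <= s j)%N -> (j' < K)%N -> (1 <= i' <= s j')%N ->
  interior (cell j i : set (subspace S2)) x ->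
  interior (cell j' i' : set (subspace S2)) x -> j = j' /\ i = i'.
Proof.
move=> jK iP jK' iP' /interior_subset xc xc'.
have pj : polar j < polar j.+1 by apply: polar_lt; lia.
have [a [p [aP pP]]] := spherical_box_interior_dense (arc_lt jK (ltnSn i)) pj xc xc'.
have [b0 b1] : 0 <= polar j /\ polar j.+1 <= pi.
  by have := polar_bound (ltnW jK); have := polar_bound jK; lra.
have [b0' b1'] : 0 <= polar j' /\ polar j'.+1 <= pi.
  by have := polar_bound (ltnW jK'); have := polar_bound jK'; lra.
have pPi : 0 < p < pi by lra.
move=> /(sph_in_box _ _ _ pPi b0' b1')[[k kP] pP'].
have jj' : j = j'.
  apply/eqP; case: ltngtP => // jj'.
  - have : polar j.+1 <= polar j' by rewrite polar_le// jj' ltnW.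
    lra.
  - have : polar j'.+1 <= polar j by rewrite polar_le// jj' ltnW.
    lra.
split => //; subst j'; rewrite -!/(arc j _) in kP.
case/andP: iP => /(arc_le jK) lo /(@arc_le j i.+1 (s j).+1 jK) hi.
case/andP: iP' => /(arc_le jK) lo' /(@arc_le j i'.+1 (s j).+1 jK) hi'.
rewrite arc_full// in hi hi'.
have pi0 := pi_gt0 R.
(* Both boxes lie in the same closed turn and [a] is strictly inside it, so the shift is less than a
   full turn. *)
have k1 : -1 < k.
  rewrite -(ltr_int R) -(ltr_pM2l (_ : 0 < 2 * pi)) ?mulr_gt0//; lra.
have k2 : k < 1.
  rewrite -(ltr_int R) -(ltr_pM2l (_ : 0 < 2 * pi)) ?mulr_gt0//; lra.
have k0 : k = 0 by clear -k1 k2; lia.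
rewrite k0 mulr0 addr0 in kP.
apply/eqP; case: ltngtP => // ii'.
- have := @arc_le j i.+1 i' jK ii'; lra.
- have := @arc_le j i'.+1 i jK ii'; lra.
Qed.

Lemma area_cell j i : (j < K)%N ->
  area (cell j i) = (4 * pi / (zone_sum K)%:R)%:E.
Proof.
move=> jK; have sj := s_gt0 jK; have pi0 := pi_gt0 R.
have b := polar_bound (ltnW jK); have b' := polar_bound jK.
have pj : polar j < polar j.+1 by apply: polar_lt; lia.
have aS := arcS j i.
have sR : 1 <= (s j)%:R :> R by rewrite ler1n.
have sle : 2 * pi / (s j)%:R <= 2 * pi :> R by rewrite ler_piMr ?invf_le1//; lra.
have s0 : 0 < 2 * pi / (s j)%:R :> R by rewrite divr_gt0; lra.
have aP : arc j i < arc j i.+1 <= arc j i + 2 * pi by lra.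
case/andP: b => b0 _; case/andP: b' => _ b1.
transitivity ((arc j i.+1 - arc j i) * (cos (polar j) - cos (polar j.+1)))%:E.
  exact: area_spherical_box.
rewrite !cos_polar ?(ltnW jK)// aS; congr EFin.
rewrite /height zone_sumS natrD; field.
by have := zone_sum_gt0; lra.
Qed.

Definition cell_indices : set (nat * nat) :=
  [set ji | (ji.1 < K)%N /\ (1 <= ji.2 <= s ji.1)%N].

Lemma card_cell_indices : (cell_indices #= `I_(zone_sum K))%card.
Proof.
pose T := {j : 'I_K & 'I_(s j)}.
have cT : #|{: T}| = zone_sum K.
  rewrite card_tagged sumnE big_map big_enum /= /zone_sum big_mkord.
  by apply: eq_bigr => j _; rewrite card_ord.
(* The successor matches ordinals from 0 with boxes from 1. *)
pose g (u : T) : nat * nat := (tag u : nat, (tagged u).+1).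
have -> : cell_indices = g @` setT.
  apply/seteqP; split=> [[j [|i]] [/= jK // iP]|_ [[j i] _ <-]] /=.
    by exists (existT (fun j : 'I_K => 'I_(s j)) (Ordinal jK) (Ordinal iP)).
  by split => /=.
rewrite -cT.
have gI : {in [set: T] &, injective g}.
  move=> [j i] [j' i'] _ _ [] /val_inj jj'; subst j' => ii'.
  by congr existT; apply/val_inj.
apply: card_eq_trans (inj_card_eq gI) _.
have rI : {in [set: T] &, injective (@enum_rank T)}.
  by move=> u v _ _; exact: enum_rank_inj.
apply: card_eq_trans; first by rewrite card_eq_sym; exact: inj_card_eq rI.
rewrite card_eq_sym; apply: card_eq_trans card_II _.
rewrite (_ : _ @` _ = setT)//.
by apply/seteqP; split => // u _; exists (enum_val u); rewrite ?enum_valK.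
Qed.

(** Allows any relabelling of the boxes, so that the caps can keep names of their own. *)
Lemma zonal_area_regular_partition (I : Type) (D : set I)
    (F : I -> set 'rV[R]_3) (idx : nat * nat -> I) :
  D = idx @` cell_indices -> {in cell_indices &, injective idx} ->
  (forall j i, cell_indices (j, i) -> F (idx (j, i)) = cell j i) ->
  area_regular_partition D F (zone_sum K)%:R.
Proof.
move=> -> idxI FE; split.
- exists (zone_sum K) => //.
  exact: card_eq_trans (inj_card_eq idxI) card_cell_indices.
- apply/seteqP; split=> [x [_ [[j i] ji <-]]|x].
    by rewrite FE//; exact: cell_sub_S2.
  move=> /cell_cover[j [i [jK iP xc]]]; exists (idx (j, i)); last by rewrite FE.
  by exists (j, i).
- move=> _ _ [[j i] ji <-] [[j' i'] ji' <-].
  rewrite !FE// => -[x [xc xc']].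
  case: (ji) (ji') => /= jK iP [/= jK' iP'].
  by have [-> ->] := cell_interior_disjoint jK iP jK' iP' xc xc'.
- by move=> _ [[j i] ji <-]; rewrite FE// area_cell//; case: ji.
Qed.

End ZonalPartition.

(** * The Diamond regions as boxes of a symmetric zonal partition *)

Section DiamondPartition.
Set Implicit Arguments.
Unset Strict Implicit.
Unset Printing Implicit Defensive.
Context {R : realType} (M : nat) (r : R -> R) (theta : nat -> R).
Context (s : nat -> nat) (M_gt0 : (0 < M)%N).
Context (s_gt0 : forall [j], (j < (2 * M).+1)%N -> (0 < s j)%N).
Context (s_sym : forall [j], (j <= 2 * M)%N -> s (2 * M - j)%N = s j).
Context (s_North : s 0%N = 1%N).
Context (s_rj : forall [j], (0 < j < 2 * M)%N -> rj r j = (s j)%:R).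

Local Notation K := (2 * M).+1.
Local Notation height := (@height R K s).
Local Notation polar := (@polar R K s).
Local Notation cell := (cell K s theta).

Lemma s_South : s (2 * M)%N = 1%N.
Proof. by rewrite -(s_sym (leqnn _)) subnn. Qed.

(** The leading 1 in [Nj] counts the North cap, which is belt 0. *)
Lemma Nj_zone_sum j : (0 < j <= 2 * M)%N -> Nj r j = (zone_sum s j)%:R.
Proof.
move=> /andP[j0 jM]; rewrite /Nj /zone_sum big_ltn// s_North natrD natr_sum.
congr (_ + _); apply: eq_big_nat => k /andP[k1 kj]; rewrite s_rj//; lia.
Qed.

Lemma Ntot_zone_sum : Ntot M r = (zone_sum s K)%:R.
Proof.
have := @Nj_zone_sum (2 * M); rewrite leqnn => /(_ ltac:(lia)) NE.
by rewrite zone_sumS s_South natrD -NE /Ntot /Nj; ring.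
Qed.

Lemma hj_height j : (0 < j <= 2 * M)%N -> hj M r j = height j.
Proof. by move=> jP; rewrite /hj Nj_zone_sum// Ntot_zone_sum. Qed.

(** The equator exchanges belts [j] and [2 * M - j], hence the parallels [j] and [K - j]: there is
    one more parallel than belts. *)
Lemma zone_sum_sym j : (j <= K)%N ->
  (zone_sum s j + zone_sum s (K - j) = zone_sum s K)%N.
Proof.
elim: j => [_|j IH jK]; first by rewrite {1}/zone_sum big_geq// subn0.
rewrite -IH ?(ltnW jK)// (_ : (K - j)%N = (K - j.+1).+1); last lia.
rewrite !zone_sumS (_ : (K - j.+1)%N = (2 * M - j)%N); last lia.
by rewrite s_sym; lia.
Qed.

Lemma height_sym j : (j <= K)%N -> height (K - j)%N = - height j.
Proof.
move=> jK; have N0 := @zone_sum_gt0 R K s isT s_gt0.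
have E : (zone_sum s j)%:R + (zone_sum s (K - j))%:R = (zone_sum s K)%:R :> R.
  by rewrite -natrD zone_sum_sym.
rewrite /height (_ : (zone_sum s (K - j))%:R = (zone_sum s K)%:R - (zone_sum s j)%:R).
  by field; lra.
lra.
Qed.

Lemma polar_sym j : (j <= K)%N -> pi - polar j = polar (K - j)%N.
Proof.
move=> jK; rewrite /polar height_sym// acosN//.
by have := @height_bound R K s isT s_gt0 j jK.
Qed.

Definition diamond_index (ji : nat * nat) : region_index :=
  if ji.1 == 0%N then North else if ji.1 == (2 * M)%N then South
  else Belt ji.1 ji.2.

Lemma diamond_index_image :
  region_indices M r = diamond_index @` cell_indices K s.
Proof.
apply/seteqP; split=> [[||j i]|_ [[j i] [/= jK iP] <-]] /=.
- by exists (0%N, 1%N) => //; split => //=; rewrite s_North.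
- exists ((2 * M)%N, 1%N); first by split => //=; rewrite s_South.
  by rewrite /diamond_index /= eqxx ifF//; apply/negbTE; lia.
- move=> [jP [i1 ir]]; exists (j, i).
    split => /=; first lia.
    by move: ir; rewrite s_rj ?ler_nat ?i1//; lia.
  by rewrite /diamond_index /= !ifF//; apply/negbTE; lia.
- rewrite /diamond_index /=; case: eqP => // j0; case: eqP => // j2M /=.
  by case/andP: iP => i1 ir; rewrite s_rj ?ler_nat//; [split|]; lia.
Qed.

Lemma diamond_index_inj : {in cell_indices K s &, injective diamond_index}.
Proof.
move=> [j i] [j' i']; rewrite !inE => -[/= jK iP] [/= jK' iP'].
rewrite /diamond_index /=.
(* A cap has only the box 1, so forgetting the box number there loses nothing. *)
have one k k' : s k = 1%N -> (1 <= k' <= s k)%N -> k' = 1%N by move=> ->; lia.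
have N1 := one _ _ s_North; have S1 := one _ _ s_South.
case: (eqVneq j 0%N) => [j0|j0]; case: (eqVneq j' 0%N) => [j0'|j0'].
- by subst => _; rewrite (N1 _ iP) (N1 _ iP').
- by case: ifP.
- by case: ifP.
- case: (eqVneq j (2 * M)%N) => [j2|j2]; case: (eqVneq j' (2 * M)%N) => [j2'|j2'] //.
  + by subst => _; rewrite (S1 _ iP) (S1 _ iP').
  + by case=> -> ->.
Qed.

(** Caps are full belts, northern boxes agree directly, and the edges written with [pi - acos] are
    reflected parallels. *)
Lemma region_cell j i : cell_indices K s (j, i) ->
  region M r theta (diamond_index (j, i)) = cell j i.
Proof.
move=> [/= jK iP]; rewrite /diamond_index /=.
have cE k : (k < K)%N -> s k = 1%N -> cell k 1 = _ :=
  @cell_full R K s theta isT s_gt0 k.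
have hN := @height0 R K s.
have hS := @heightK R K s isT s_gt0.
case: eqP => [j0|/eqP j0].
  subst j; rewrite s_North in iP; have -> : i = 1%N by lia.
  rewrite cE//= hj_height ?hN; last lia.
  (* The other height bound of the cap holds for every point of the sphere. *)
  by apply/seteqP; split=> x [xS xh]; split => //;
    have := S2_height_bound xS; lra.
case: eqP => [j2|/eqP j2].
  subst j; rewrite s_South in iP; have -> : i = 1%N by lia.
  rewrite cE ?s_South//= hj_height ?hS; last lia.
  have -> : - height 1 = height (2 * M).
    by rewrite -height_sym// subn1.
  by apply/seteqP; split=> x [xS xh]; split => //;
    have := S2_height_bound xS; lra.
rewrite /region /belt_region /cell.
case: ltnP => jM.
  by rewrite s_rj ?hj_height//; lia.
case: eqP => [jM'|/eqP jM'].
  subst j; rewrite s_rj ?hj_height//; try lia.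
  rewrite -/(polar M) polar_sym; last lia.
  by have -> : (K - M)%N = M.+1 by lia.
rewrite s_rj ?s_sym ?hj_height//; try lia.
rewrite -!/(polar _) !polar_sym; try lia.
have -> : (K - (2 * M - j).+1)%N = j by lia.
by have -> : (K - (2 * M - j))%N = j.+1 by lia.
Qed.

Lemma diamond_partition :
  area_regular_partition (region_indices M r) (region M r theta) (Ntot M r).
Proof.
rewrite Ntot_zone_sum.
exact: (@zonal_area_regular_partition R K s theta isT s_gt0 _ _ _ _
  diamond_index_image diamond_index_inj region_cell).
Qed.

End DiamondPartition.

(** * Positivity and integrality of the belt sizes *)

Lemma piecewise_affine_natural (R : realType) (M n : nat)
    (t alpha beta : nat -> int) (r : R -> R)
    (n_gt0 : (0 < n)%N) (t_0 : t 0%N = 0) (t_n : t n = M%:Z)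
    (t_incr : forall l, (1 <= l <= n)%N -> t l.-1 < t l)
    (alpha_1 : alpha 1%N = 0) (beta_1 : 0 < beta 1%N)
    (beta_ge0 : forall l, (1 <= l <= n)%N -> 0 <= beta l)
    (r_affine : forall l x, (1 <= l <= n)%N ->
       (t l.-1)%:~R <= x <= (t l)%:~R ->
       r x = (alpha l)%:~R + (beta l)%:~R * x) (j : nat) :
  (0 < j <= M)%N -> exists2 m : nat, (0 < m)%N & r j%:R = m%:R.
Proof.
move=> /andP[j0 jM].
have rz l (k : int) : (1 <= l <= n)%N -> t l.-1 <= k <= t l ->
    r k%:~R = (alpha l + beta l * k)%:~R.
  by move=> lP kP; rewrite (r_affine l)// ?intrD ?intrM// !ler_int.
have t_ge0 l : (l <= n)%N -> 0 <= t l.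
  elim: l => [|l IH] ln; first by rewrite t_0.
  exact: le_trans (IH (ltnW ln)) (ltW (t_incr l.+1 ln)).
(* Both affine formulas compute [r] at the common endpoint [t l]. *)
have glue l : (1 <= l < n)%N ->
    alpha l.+1 + beta l.+1 * t l = alpha l + beta l * t l.
  move=> /andP[l1 ln]; apply: (@intr_inj R).
  have lP : (1 <= l <= n)%N by rewrite l1 ltnW.
  have lo := ltW (t_incr _ lP); have hi : t l <= t l.+1 := ltW (t_incr l.+1 ln).
  by rewrite -!rz //= lexx ?lo ?hi.
(* Induction on the pieces: the first has zero intercept and positive slope; each later one starts
   at the positive end value of the previous piece and does not decrease. *)
have pos l (k : int) : (1 <= l <= n)%N -> t l.-1 <= k -> 0 < k ->
    0 < alpha l + beta l * k.
  elim: l k => // -[|l] IH k lP lk k0.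
    by rewrite alpha_1 add0r mulr_gt0.
  have lP' : (1 <= l.+1 <= n)%N := ltnW lP.
  have tl := t_incr _ lP'; rewrite /= in tl lk.
  apply: (@lt_le_trans _ _ (alpha l.+2 + beta l.+2 * t l.+1)).
    rewrite glue//; apply: IH => //=; first exact: ltW.
    by rewrite (le_lt_trans _ tl)// t_ge0// ltnW// ltnW.
  by rewrite lerD2l ler_wpM2l ?beta_ge0.
have [l ln lj] : exists2 l, (l < n)%N & (t l)%:~R <= (j%:R : R) <= (t l.+1)%:~R.
  apply: (@subdivision_cover R (fun l => (t l)%:~R)) => //=.
  by rewrite t_0 t_n ler0n ler_nat.
have lj' : t l <= j%:Z <= t l.+1 by rewrite -!(ler_int R).
have v0 : 0 < alpha l.+1 + beta l.+1 * j%:Z.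
  by apply: pos => //; case/andP: lj'.
exists (absz (alpha l.+1 + beta l.+1 * j%:Z)); first by rewrite absz_gt0 gt_eqF.
by rewrite natr_absz ger0_norm ?ltW// -(rz l.+1 j%:Z ln lj').
Qed.

Theorem proposition3p2 (R : realType) (M n : nat) (A c : R)
    (t alpha beta : nat -> int) (r : R -> R) (theta : nat -> R)
    (M_gt0 : (0 < M)%N) (n_gt0 : (0 < n)%N) (A_ge2 : 2 <= A) (c_gt0 : 0 < c)
    (t_0 : t 0%N = 0) (t_n : t n = M%:Z)
    (t_incr : forall l, (1 <= l <= n)%N -> t l.-1 < t l)
    (alpha_1 : alpha 1%N = 0) (beta_1 : 0 < beta 1%N)
    (alpha_ge0 : forall l, (1 <= l <= n)%N -> 0 <= alpha l)
    (beta_ge0 : forall l, (1 <= l <= n)%N -> 0 <= beta l)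
    (alpha_le : forall l, (1 <= l <= n)%N -> (alpha l)%:~R <= A * M%:R)
    (beta_le : forall l, (1 <= l <= n)%N -> (beta l)%:~R <= A)
    (t_1 : c * M%:R <= (t 1%N)%:~R)
    (r_affine : forall l x, (1 <= l <= n)%N ->
       (t l.-1)%:~R <= x <= (t l)%:~R ->
       r x = (alpha l)%:~R + (beta l)%:~R * x)
    (r_sym : forall x, 0 <= x <= 2 * M%:R -> r x = r (2 * M%:R - x))
    (r_cont : {within `[0, 2 * M%:R], continuous r})
    (theta_bnd : forall j, (1 <= j <= 2 * M - 1)%N -> 0 <= theta j <= 2 * pi) :
  area_regular_partition (region_indices M r) (region M r theta) (Ntot M r).
Proof.
have rS j : (j <= 2 * M)%N -> r (2 * M - j)%:R = r j%:R.
  by move=> jM; rewrite natrB// natrM -r_sym// -natrM ler0n ler_nat.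
have rN j : (0 < j < 2 * M)%N -> exists2 m : nat, (0 < m)%N & r j%:R = m%:R.
  move=> jP; have nat_r := piecewise_affine_natural n_gt0 t_0 t_n t_incr alpha_1
    beta_1 beta_ge0 r_affine.
  have [jM|jM] := leqP j M; first by apply: nat_r; lia.
  by rewrite -rS; [apply: nat_r|]; lia.
(* The value 1 at [0] and [2 * M] makes the caps belts with one box; elsewhere [Num.truncn] recovers
   the natural number [r j%:R]. *)
pose s j := if (0 < j < 2 * M)%N then Num.truncn (r j%:R) else 1%N.
apply: (@diamond_partition R M r theta s) => // [j _|j jM|j jP].
- rewrite /s; case: ifP => // /rN[m m0 ->]; by rewrite natrK.
- rewrite /s rS// (_ : (0 < 2 * M - j < 2 * M)%N = (0 < j < 2 * M)%N)//; lia.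
- by rewrite /rj /s jP; have [m _ ->] := rN _ jP; rewrite natrK.
Qed.
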